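(* Fix integers $k\ge 2$ and $k\le\delta\le 2k-1$, set $h=\delta-k$, and let $n\ge 2\delta+2$. Every graph $G\in\mathcal{L}_{\mathcal{H}}^{2}(n,k,\delta)$ admits a partition $V(G)=X\,\dot\cup\,W\,\dot\cup\,Y$ with $$|X|=2h+2,\qquad |W|=k-h-1,\qquad |Y|=n-k-h-1,$$ such that $W\cup Y$ induces a clique, $W$ is complete to $X$, and $E(G[X])=E(K_X)\setminus E(M)$ for a simple graph $M$ on $X$. Moreover, let $B$ be the bipartite graph on $X\cup Y$ with bipartition $(X,Y)$ and edge set $E_G(X,Y)$ (the set of edges of $G$ between $X$ and $Y$). Then $$e(M)=h,\qquad e(B)=2h,\qquad d_B(x)=d_M(x)\ \text{ for every }x\in X.$$ Conversely, suppose that pairwise disjoint sets $X,W,Y$ have the displayed cardinalities, that $M$ is a simple graph on $X$ and $B$ is a bipartite graph with bipartition $(X,Y)$, and that $e(M)=h$, $e(B)=2h$ and $d_B(x)=d_M(x)$ for every $x\in X$. Define the graph $G_h(M,B)$ on $X\,\dot\cup\,W\,\dot\cup\,Y$ by requiring that $E(G_h(M,B)[X])=E(K_X)\setminus E(M)$, that $W\cup Y$ induce a clique, that $W$ be complete to $X$, and that the $X$--$Y$ edges be precisely the edges of $B$. Then $G_h(M,B)\in\mathcal{L}_{\mathcal{H}}^{2}(n,k,\delta)$. Moreover, every vertex of $X$ has degree exactly $\delta$ in $G_h(M,B)$, whereas every vertex of $W\cup Y$ has degree at least $\delta$. Consequently, the minimum degree of $G_h(M,B)$ equals $\delta$.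
   Context: All graphs are finite, simple and undirected; $e(\cdot)$ is the number of edges and $d_F(x)$ is the degree of $x$ in the graph $F$. Family $\mathcal{L}_{\mathcal{H}}^{2}(n,k,\delta)$ (with $h=\delta-k$): it consists of all graphs $G$ (up to isomorphism) obtained as follows. Take pairwise disjoint vertex sets $X,W,Y$ with $|X|=2h+2$, $|W|=k-h-1$, $|Y|=n-k-h-1$. Choose a connected graph $H$ with vertex set $X$ and exactly $\binom{2h+2}{2}-h$ edges. Start from the graph $K_W\vee(H\cup K_Y)$, where $K_W,K_Y$ are the complete graphs on $W,Y$ ($K_\varnothing$ is the empty graph), $\cup$ is disjoint union and $\vee$ is the graph join. Then add a set of exactly $2h$ edges, each joining a vertex of $X$ to a vertex of $Y$, in such a way that every vertex of $X$ has degree at least $\delta$ in the resulting graph $G$. *)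

(* Defs.v *)
From mathcomp Require Import all_boot.

Set Implicit Arguments.
Unset Strict Implicit.
Unset Printing Implicit Defensive.

Section Graphs.
Variable T : finType.
Implicit Types (A B S U W X Y : {set T}) (F : {set {set T}}).

Definition pairs S : {set {set T}} := [set e : {set T} | (e \subset S) && (#|e| == 2)].

(* Graphs have an explicit vertex set inside an ambient finite type, so that
   several graphs on different vertex sets (G, G[X], M on X, B on X :|: Y)
   share their vertices; an edge is a two-element set of vertices. *)
Record graph := Graph {
  vset : {set T};
  eset : {set {set T}};
  eset_pairs : eset \subset pairs vset }.

Implicit Types G H M : graph.

Definition adj G : rel T := fun x y => [set x; y] \in eset G.
Definition deg G x := #|[set y | adj G x y]|.
Definition esize G := #|eset G|.

(* Every degree is smaller than #|vset G|, so for a nonempty graph the default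
   value of the iterated minimum plays no role. *)
Definition min_degree G := \big[minn/#|vset G|]_(x in vset G) deg G x.

Definition connected G := {in vset G &, forall x y, connect (adj G) x y}.

Definition is_clique G S := {in S &, forall x y, x != y -> adj G x y}.
Definition complete_to G A B := {in A & B, forall x y, adj G x y}.

Definition between A B : {set {set T}} :=
  [set [set x; y] | x in A, y in B & x != y].

Lemma pairsS A B : A \subset B -> pairs A \subset pairs B.
Proof.
move=> sAB; apply/subsetP=> e; rewrite !inE => /andP[/subset_trans-> //].
Qed.

Lemma eset_sub G A : vset G \subset A -> eset G \subset pairs A.
Proof. by move=> /pairsS; apply: subset_trans (eset_pairs G). Qed.

Lemma between_pairs A B : between A B \subset pairs (A :|: B).
Proof.
apply/subsetP=> _ /imset2P[x y xA /[!inE]/andP[yB xDy] ->].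
by rewrite subUset !sub1set !inE xA yB cards2 xDy orbT.
Qed.

Definition complete S : graph := Graph (subxx (pairs S)).

Fact induced_subproof G S : eset G :&: pairs S \subset pairs S.
Proof. exact: subsetIr. Qed.
Definition induced G S : graph := Graph (induced_subproof G S).

Fact del_edges_subproof G F : eset G :\: F \subset pairs (vset G).
Proof. exact: subset_trans (subsetDl _ _) (eset_pairs G). Qed.
Definition del_edges G F : graph := Graph (del_edges_subproof G F).

(* Vertex sets may overlap; this is the disjoint union when they do not. *)
Fact gunion_subproof G H :
  eset G :|: eset H \subset pairs (vset G :|: vset H).
Proof. by rewrite subUset !eset_sub ?subsetUl ?subsetUr. Qed.
Definition gunion G H : graph := Graph (gunion_subproof G H).

Definition biclique A B : graph := Graph (between_pairs A B).

Definition gjoin G H : graph :=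
  gunion (gunion G H) (biclique (vset G) (vset H)).

(* The graph on X :|: Y with edge set E_G(X,Y). *)
Fact crossing_subproof G X Y :
  eset G :&: between X Y \subset pairs (X :|: Y).
Proof. exact: subset_trans (subsetIr _ _) (between_pairs X Y). Qed.
Definition crossing G X Y : graph := Graph (crossing_subproof G X Y).

Definition is_bipartition G X Y :=
  [/\ vset G = X :|: Y, [disjoint X & Y] & eset G \subset between X Y].

Definition pairwise_disjoint X W Y :=
  [/\ [disjoint X & W], [disjoint X & Y] & [disjoint W & Y]].

(* The subtractions do not truncate when k <= delta <= 2k-1 and
   n >= 2 * delta + 2. *)
Definition part_sizes n k h X W Y :=
  [/\ #|X| = 2 * h + 2, #|W| = k - h - 1 & #|Y| = n - k - h - 1].

(* The family L_H^2(n,k,delta).  It is closed under isomorphism, since X, W, Y,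
   H and the added edges F are arbitrary in an arbitrary ambient type. *)
Definition L2H n k delta G : Prop :=
  let h := delta - k in
  exists X W Y H F,
    [/\ pairwise_disjoint X W Y /\ part_sizes n k h X W Y,
        [/\ vset H = X, connected H & esize H = 'C(2 * h + 2, 2) - h],
        F \subset between X Y /\ #|F| = 2 * h,
        let G0 := gjoin (complete W) (gunion H (complete Y)) in
        vset G = vset G0 /\ eset G = eset G0 :|: F
      & {in X, forall x, delta <= deg G x}].

Definition Gh X W Y M (B : graph) : graph :=
  gunion (gunion (del_edges (complete X) (eset M)) (complete (W :|: Y)))
         (gunion (biclique W X) B).

End Graphs.

(* Main.v *)
Require Import Defs.
From mathcomp Require Import all_boot zify.

Set Implicit Arguments.
Unset Strict Implicit.
Unset Printing Implicit Defensive.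

(** Write [M] for the complement of [H] inside the complete graph on [X], and
    [B] for the bipartite graph of the added [X]-[Y] edges.  Then the graphs of
    the family are the graphs [Gh X W Y M B] ([eset_join_Gh]), and a vertex [x]
    of [X] has [#|X| - 1 - deg M x] neighbours in [X], all of [W], and
    [deg B x] neighbours in [Y]; since [#|X| - 1 + #|W| = k + h = delta],
      [deg G x + deg M x = delta + deg B x]            ([deg_Gh_X]).
    So the condition [delta <= deg G x] on [X] says [deg M x <= deg B x].
    By double counting ([sum_deg]) the degrees of [M] over [X] sum to [2 * h],
    as [M] has [h] edges with both ends in [X], and those of [B] also sum to
    [2 * h], as [B] has [2 * h] edges with one end in [X].  Hence all these
    inequalities are equalities, which is the direct part.

    For the converse the same identity gives [deg G x = delta] on [X], while
    the clique [W :|: Y] already gives each of its vertices at least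
    [2 * k - 1 >= delta] neighbours.  The remaining point is that [K_X - M] is
    connected: two nonadjacent vertices of [X] have [2 * h] candidate common
    neighbours, and the [h - 1] edges of [M] other than the one joining these
    two vertices cannot spoil all the candidates ([connected_del_edges]). *)

Section Proof.
Variable T : finType.
Implicit Types (A S U W X Y : {set T}) (G H M B : graph T).

(** * Edge sets *)

Lemma pairsP S (e : {set T}) :
  reflect (exists x y, [/\ x \in S, y \in S, x != y & e = [set x; y]])
          (e \in pairs S).
Proof.
rewrite inE; apply: (iffP andP) => [[eS /cards2P[x [y [xDy e_xy]]]]|].
  exists x, y; move: eS; rewrite e_xy subUset !sub1set => /andP[xS yS].
  by split.
case=> x [y [xS yS xDy ->]].
by rewrite subUset !sub1set xS yS cards2 xDy.
Qed.

Lemma in_pairs S x y :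
  ([set x; y] \in pairs S) = [&& x \in S, y \in S & x != y].
Proof.
by rewrite inE subUset !sub1set cards2; case: (x != y); rewrite ?andbF ?andbT.
Qed.

Lemma betweenP A U (e : {set T}) :
  reflect (exists x y, [/\ x \in A, y \in U, x != y & e = [set x; y]])
          (e \in between A U).
Proof.
apply: (iffP imset2P) => [[x y xA]|[x [y [xA yU xDy ->]]]].
  by rewrite inE => /andP[yU xDy] ->; exists x, y.
by exists x y => //; rewrite inE yU.
Qed.

Lemma in_between A U x y : [set x; y] \in between A U =
  (x != y) && ((x \in A) && (y \in U) || (y \in A) && (x \in U)).
Proof.
apply/betweenP/idP => [[a [b [aA bU aDb]]]|].
  move/setP=> E; have := E a; have := E b; rewrite !inE !eqxx !orbT.
  case/pred2P=> eb; case/pred2P=> ea; move: aA bU aDb; rewrite ea eb ?eqxx //.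
    by move=> -> ->; rewrite eq_sym orbT => ->.
  by move=> -> -> ->.
case/andP=> xDy /orP[/andP[xA yU]|/andP[yA xU]]; first by exists x, y.
by exists y, x; rewrite eq_sym setUC.
Qed.

Lemma pairsU A U : pairs (A :|: U) = pairs A :|: pairs U :|: between A U.
Proof.
apply/setP=> e; rewrite 2!in_setU; apply/idP/idP.
  case/pairsP=> x [y [+ + xDy ->]].
  rewrite !in_pairs in_between xDy !inE.
  by do 4![case: (_ \in _)].
case/orP; last exact/subsetP/between_pairs.
by case/orP; apply/subsetP/pairsS; rewrite ?subsetUl ?subsetUr.
Qed.

Lemma betweenUr A U S : between A (U :|: S) = between A U :|: between A S.
Proof.
apply/setP=> e; rewrite in_setU; apply/betweenP/orP.
  case=> x [y [xA /setUP[yU|yS] xDy ->]]; [left|right];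
    by rewrite in_between xDy xA ?yU ?yS.
by case=> /betweenP[x [y [xA yU xDy ->]]]; exists x, y; rewrite inE yU ?orbT.
Qed.

(** The join in the definition of the family regroups into the clique on
    [W :|: Y], the [W]-[X] edges, the complement of [M] on [X], and [B]. *)
Lemma eset_join_Gh X W Y H M B :
    vset H = X -> eset H = pairs X :\: eset M ->
  eset (gjoin (complete W) (gunion H (complete Y))) :|: eset B
    = eset (Gh X W Y M B).
Proof.
move=> HX HM; rewrite /= HX HM pairsU betweenUr.
by apply/setP=> e; rewrite !in_setU; do !case: (e \in _).
Qed.

Lemma adjC G x y : adj G x y = adj G y x.
Proof. by rewrite /adj setUC. Qed.

Lemma adj_vset G x y :
  adj G x y -> [/\ x \in vset G, y \in vset G & x != y].
Proof. by move/(subsetP (eset_pairs G)); rewrite in_pairs => /and3P. Qed.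

Lemma eq_deg G H x : eset G = eset H -> deg G x = deg H x.
Proof. by move=> E; apply: eq_card => y; rewrite !inE /adj E. Qed.

(** * Double counting *)

Lemma deg_incident G x : deg G x = #|[set e in eset G | x \in e]|.
Proof.
rewrite /deg -(@card_in_imset _ _ (fun y => [set x; y])); last first.
  move=> y z; rewrite !inE => /adj_vset[_ _ xDy] _ /setP/(_ y).
  by rewrite !inE eqxx orbT eq_sym (negPf xDy) => /esym/eqP.
apply: eq_card => e; rewrite !inE; apply/imsetP/andP.
  by case=> y; rewrite inE => xy ->; rewrite !inE eqxx.
case=> eG; have /pairsP[a [b [_ _ _ e_ab]]] := subsetP (eset_pairs G) e eG.
rewrite e_ab !inE => /pred2P[] xE; [exists b|exists a];
  by rewrite ?inE /adj xE // -?e_ab // setUC -?e_ab.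
Qed.

(** Counting incident pairs (vertex of [A], edge): with [c = 2] this is the
    handshake lemma, with [c = 1] its form for one side of a bipartition. *)
Lemma sum_deg G A c :
    {in eset G, forall e : {set T}, #|e :&: A| = c} ->
  \sum_(x in A) deg G x = c * esize G.
Proof.
move=> eA; under eq_bigr do rewrite deg_incident -sum1dep_card.
rewrite (exchange_big_dep (mem (eset G))) /=; last by move=> x e _ /andP[].
transitivity (\sum_(e in eset G) c); last by rewrite sum_nat_const mulnC.
apply: eq_bigr => e eG; rewrite -(eA e eG) -sum1_card.
by apply: eq_bigl => x; rewrite inE eG andbC.
Qed.

Lemma handshake G : \sum_(x in vset G) deg G x = 2 * esize G.
Proof.
apply: sum_deg => e /(subsetP (eset_pairs G)); rewrite inE => /andP[eV /eqP<-].
by move/setIidPl: eV => ->.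
Qed.

Lemma sum_deg_bipartition B X Y :
  is_bipartition B X Y -> \sum_(x in X) deg B x = esize B.
Proof.
case=> _ dXY BXY; rewrite -[RHS]mul1n; apply: sum_deg => e /(subsetP BXY).
case/betweenP=> x [y [xX yY _ ->]]; apply/eqP/cards1P; exists x.
apply/setP=> z; rewrite !inE; case: eqVneq => [->//|_] /=.
by case: eqVneq => [->|]//=; rewrite (disjointFl dXY).
Qed.

(** * The graph K_X - M *)

Lemma card_pairs S : #|pairs S| = 'C(#|S|, 2).
Proof. exact: cards_draws. Qed.

Lemma esize_compl S G :
    eset G \subset pairs S ->
  esize (del_edges (complete S) (eset G)) = 'C(#|S|, 2) - esize G.
Proof. by move=> GS; rewrite /esize cardsD card_pairs (setIidPr GS). Qed.

Lemma deg_compl M x :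
    x \in vset M ->
  deg (del_edges (complete (vset M)) (eset M)) x + deg M x = #|vset M|.-1.
Proof.
move=> xX; rewrite [in RHS](cardsD1 x) xX /=.
rewrite -[RHS](cardsID [set y | adj M x y]) addnC; congr (_ + _);
  apply: eq_card => y; rewrite !inE /adj.
- case: (boolP (_ \in eset M)) => [/adj_vset[_ yX xDy]|_]; last by rewrite andbF.
  by rewrite eq_sym xDy yX.
- by rewrite in_setD in_pairs xX eq_sym /= (andbC (y \in _)).
Qed.

(** If nonadjacent [x] and [y] had no common neighbour, every other vertex [z]
    would be joined in [M] to [x] or [y]; these edges are distinct for distinct
    [z], and [M] would have at least [#|vset M| - 2] edges besides. *)
Lemma connected_del_edges M :
    esize M < #|vset M|.-1 ->
  connected (del_edges (complete (vset M)) (eset M)).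
Proof.
set X := vset M => ltM x y; set H := del_edges _ _; rewrite -[vset H]/X => xX yX.
have adjH u v : u \in X -> v \in X -> u != v -> adj H u v = ~~ adj M u v.
  by move=> uX vX uDv; rewrite /adj in_setD in_pairs uX vX uDv /= andbT.
have [->|xDy] := eqVneq x y; first exact: connect0.
have [Mxy|?] := boolP (adj M x y); last by apply: connect1; rewrite adjH.
have [z /and3P[zS Mxz Myz]|noz] :=
    pickP [pred z | [&& z \in X :\: [set x; y], ~~ adj M x z & ~~ adj M y z]].
  move: zS; rewrite !inE negb_or -andbA => /and3P[zDx zDy zX].
  apply: (connect_trans (y := z)); apply: connect1; rewrite adjH // 1?eq_sym //.
  by rewrite adjC.
pose f z := if adj M x z then [set x; z] else [set y; z].
have f_inj : {in X :\: [set x; y] &, injective f}.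
  have fK z : z \in X :\: [set x; y] -> f z :\: [set x; y] = [set z].
    rewrite !inE negb_or => /andP[/andP[zDx zDy] _].
    rewrite /f; case: ifP => _; apply/setP=> t; rewrite !inE negb_or;
      have [->|_] := eqVneq t z; rewrite ?zDx ?zDy ?orbT //= ?orbF;
      by case: (t == x); case: (t == y).
  move=> z t zS tS /(congr1 (fun e => e :\: [set x; y])).
  by rewrite !fK // => /set1_inj.
suff: #|X|.-1 <= esize M by rewrite leqNgt ltM.
have subX : [set x; y] \subset X by rewrite subUset !sub1set xX yX.
have cX : #|X :\: [set x; y]| = #|X| - 2.
  by rewrite cardsD (setIidPr subX) cards2 xDy.
rewrite /esize (cardsD1 [set x; y]) [_ \in eset M]Mxy add1n.
have: #|f @: (X :\: [set x; y])| <= #|eset M :\ [set x; y]|.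
  apply/subset_leq_card/subsetP => _ /imsetP[z zS ->].
  have:= noz z; rewrite /= zS /= => /negbT; rewrite negb_and !negbK => Mz.
  move: zS; rewrite !inE negb_or => /andP[/andP[zDx zDy] _].
  apply/andP; split; last by rewrite /f; case: ifP Mz.
  apply/negP=> /eqP/setP/(_ z); rewrite !inE (negPf zDx) (negPf zDy).
  by rewrite /f; case: ifP => _; rewrite !inE eqxx orbT.
by rewrite card_in_imset // cX leq_subLR -subn1 leq_subLR.
Qed.

(** * Structure of the graphs [Gh X W Y M B] *)

Section Structure.
Variables (X W Y : {set T}) (M B : graph T).
Hypotheses (disj : pairwise_disjoint X W Y) (MX : vset M = X).
Hypothesis bipB : is_bipartition B X Y.
Let G := Gh X W Y M B.

Lemma Gh_clique : is_clique G (W :|: Y).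
Proof.
move=> x y xWY yWY xDy; rewrite /adj /G /= !(in_setU [set x; y]).
by rewrite in_pairs xWY yWY xDy orbT.
Qed.

Lemma Gh_complete_to : complete_to G W X.
Proof.
case: disj => dXW _ _ x y xW yX; rewrite /adj /G /= !(in_setU [set x; y]).
rewrite in_between xW yX /= andbT; suff ->: x != y by rewrite !orbT.
by apply: contraTneq xW => ->; rewrite (disjointFr dXW).
Qed.

Lemma Gh_induced : eset (induced G X) = pairs X :\: eset M.
Proof.
case: disj bipB => dXW dXY _ [_ _ BXY].
apply/setP=> e; rewrite /= !inE -/(pairs X).
have [/pairsP[x [y [xX yX xDy ->]]]|neX] := boolP (e \in pairs X); last first.
  by move: neX; rewrite inE => /negPf->; rewrite !andbF.
move: (in_pairs X x y) (in_pairs (W :|: Y) x y); rewrite !inE => -> ->.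
rewrite in_between xX yX xDy !(disjointFr dXW) //= !(disjointFr dXY) //= !andbT.
suff /negPf->: [set x; y] \notin eset B by rewrite !orbF.
apply/negP=> /(subsetP BXY); rewrite in_between xX yX /=.
by rewrite !(disjointFr dXY) ?andbF.
Qed.

Lemma Gh_crossing : eset (crossing G X Y) = eset B.
Proof.
case: disj bipB => dXW dXY dWY [_ _ BXY].
apply/setP=> e; rewrite in_setI; apply/andP/idP => [[]|eB]; last first.
  by rewrite !in_setU eB !orbT (subsetP BXY).
rewrite !in_setU => + /betweenP[x [y [xX yY xDy e_xy]]].
rewrite e_xy in_setD !in_pairs in_between !inE.
rewrite (disjointFl dXY yY) (disjointFr dXW xX) (disjointFr dXY xX).
by rewrite (disjointFl dWY yY) !andbF.
Qed.

Lemma deg_Gh_X x :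
  x \in X -> deg G x + deg M x = #|X|.-1 + #|W| + deg B x.
Proof.
move=> xX; case: disj bipB => dXW dXY dWY [VB _ BXY].
set H := del_edges (complete X) (eset M).
suff ->: deg G x = deg H x + #|W| + deg B x.
  have := @deg_compl M x; rewrite MX -/H => /(_ xX); lia.
(* The neighbours of x split into those inside X (in K_X - M), those in W and
   those in Y (in B); as X, W and Y are disjoint, the three counts add up. *)
have nB y : adj B x y -> y \in Y.
  move/(subsetP BXY); rewrite in_between xX (disjointFr dXY xX) andbF orbF.
  by case/andP.
have nH y : adj H x y -> y \in X by case/adj_vset.
have adjG y : adj G x y = [|| adj H x y, y \in W | adj B x y].
  rewrite /adj /G /= !(in_setU [set x; y]) in_pairs in_between in_setU.
  rewrite (disjointFr dXW xX) (disjointFr dXY xX) xX andbT /=.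
  rewrite orbF; case: (boolP (y \in W)) => [yW|_]; last by rewrite andbF.
  by suff ->: x != y by []; apply: contraTneq yW => <-; rewrite (disjointFr dXW).
rewrite {1}/deg (_ : [set y | adj G x y] =
    [set y | adj H x y] :|: W :|: [set y | adj B x y]); last first.
  by apply/setP=> y; rewrite !inE adjG orbA.
rewrite cardsU (_ : _ :&: _ = set0) ?cards0 ?subn0; last first.
  apply/setP=> y; rewrite !inE; case: (boolP (adj B x y)); rewrite ?andbF //.
  move=> /nB yY; rewrite (disjointFl dWY yY) orbF andbT.
  by apply/negP=> /nH; rewrite (disjointFl dXY yY).
rewrite cardsU (_ : _ :&: _ = set0) ?cards0 ?subn0 //.
apply/setP=> y; rewrite !inE; case: (boolP (adj H x y)) => // /nH yX.
by rewrite (disjointFr dXW yX).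
Qed.

Lemma deg_Gh_WY z : z \in W :|: Y -> #|W| + #|Y| <= (deg G z).+1.
Proof.
case: disj => _ _ dWY zWY; move: (dWY); rewrite -leq_card_setU => /eqP <-.
rewrite (cardsD1 z) zWY ltnS; apply/subset_leq_card/subsetP => y.
by rewrite in_setD1 inE => /andP[yDz yWY]; apply: Gh_clique; rewrite // eq_sym.
Qed.

End Structure.

Lemma min_degree_eq G d x :
    x \in vset G -> deg G x = d -> {in vset G, forall y, d <= deg G y} ->
  min_degree G = d.
Proof.
move=> xV dx ged; apply/eqP; rewrite eqn_leq; apply/andP; split.
  rewrite /min_degree; elim: (index_enum T) (mem_index_enum x) => //= y r IH.
  rewrite inE big_cons => /predU1P[<-|/IH le_d]; first by rewrite xV dx geq_minl.
  by case: ifP => // _; rewrite geq_min le_d orbT.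
rewrite /min_degree; elim/big_ind: _ => // [|a b].
  rewrite -dx; apply/subset_leq_card/subsetP => y.
  by rewrite inE => /adj_vset[].
by rewrite leq_min => -> ->.
Qed.

Lemma eq_of_leq_sum (A : {set T}) (f g : T -> nat) :
    {in A, forall x, f x <= g x} ->
    \sum_(x in A) f x = \sum_(x in A) g x ->
  {in A, forall x, f x = g x}.
Proof.
move=> lefg eqfg x xA.
have /leqif_sum[_] : forall y, y \in A -> f y <= g y ?= iff (f y == g y).
  by move=> y /lefg.
by rewrite eqfg eqxx => /esym/forall_inP/(_ x xA)/eqP.
Qed.

End Proof.

Theorem proposition2p1 (n k delta : nat) (hk : 2 <= k)
    (hkdelta : k <= delta) (hdelta : delta <= 2 * k - 1)
    (hn : 2 * delta + 2 <= n) (T : finType) :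
  let h := delta - k in
  (forall G : graph T, L2H n k delta G ->
     exists (X W Y : {set T}) (M : graph T),
       let B := crossing G X Y in
       (vset G = X :|: W :|: Y /\ pairwise_disjoint X W Y) /\
       part_sizes n k h X W Y /\
       is_clique G (W :|: Y) /\
       complete_to G W X /\
       (vset M = X /\ eset (induced G X) = eset (complete X) :\: eset M) /\
       esize M = h /\
       esize B = 2 * h /\
       {in X, forall x, deg B x = deg M x})
  /\
  (forall (X W Y : {set T}) (M B : graph T),
     pairwise_disjoint X W Y ->
     part_sizes n k h X W Y ->
     vset M = X ->
     is_bipartition B X Y ->
     esize M = h ->
     esize B = 2 * h ->
     {in X, forall x, deg B x = deg M x} ->
     let G := Gh X W Y M B in
     L2H n k delta G /\
     {in X, forall x, deg G x = delta} /\
     {in W :|: Y, forall z, delta <= deg G z} /\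
     min_degree G = delta).
Proof.
move=> h; have defh : delta = k + h by rewrite subnKC.
split=> [G [X [W [Y [H [F]]]]]|X W Y M B disj sizes MX bipB eM eB dBM G].
  case=> [[disj sizes] [HX connH eH] [FXY eF] [VG EG] degG].
  rewrite -/h in sizes eH eF.
  have [cX cW cY] := sizes.
  pose M := del_edges (complete X) (eset H).
  pose B0 := Graph (subset_trans FXY (between_pairs X Y)).
  have HpX : eset H \subset pairs X by rewrite eset_sub ?HX.
  have EH : eset H = pairs X :\: eset M.
    by rewrite setDDr setDv set0U (setIidPr HpX).
  have bipB0 : is_bipartition B0 X Y by split=> //; case: disj.
  have {}EG : eset G = eset (Gh X W Y M B0).
    by rewrite EG -(eset_join_Gh W Y B0 HX EH).
  have EB : eset (crossing G X Y) = eset B0.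
    by rewrite -(Gh_crossing M disj bipB0) /= EG.
  have eM : esize M = h.
    rewrite esize_compl // eH cX subKn //.
    by rewrite addn2 binS bin1; lia.
  have {}VG : vset G = X :|: W :|: Y.
    rewrite VG /= HX.
    by apply/setP=> x; rewrite !inE; do !case: (x \in _).
  exists X, W, Y, M.
  split; last split; last split; last split; last split; last split; last split.
  all: try by [].
  - by move=> x y xWY yWY xDy; rewrite /adj EG; apply: Gh_clique.
  - by move=> x y xW yX; rewrite /adj EG; apply: Gh_complete_to.
  - by split; last by rewrite -(Gh_induced M disj bipB0) /= EG.
  - by rewrite /esize EB.
  move=> x xX; rewrite (eq_deg x EB); apply/esym; move: x xX.
  apply: eq_of_leq_sum => [x xX|].
    have := degG x xX; rewrite (eq_deg x EG).
    have := deg_Gh_X disj (erefl : vset M = X) bipB0 xX; rewrite cX cW; lia.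
  rewrite (sum_deg_bipartition bipB0) (handshake M) eM.
  by rewrite /esize /= eF.
have [cX cW cY] := sizes.
have dX : {in X, forall x, deg G x = delta}.
  move=> x xX; have := deg_Gh_X disj MX bipB xX; rewrite -/G dBM // cX cW; lia.
have dWY : {in W :|: Y, forall z, delta <= deg G z}.
  move=> z zWY; have := deg_Gh_WY M B disj zWY; rewrite -/G cW cY; lia.
have VG : vset G = X :|: W :|: Y.
  case: bipB => VB _ _; rewrite /= VB.
  by apply/setP=> x; rewrite !inE; do !case: (x \in _).
split; last first.
  split=> //; split=> //; have [x xX] : exists x, x \in X.
    by apply/card_gt0P; rewrite cX addn2.
  apply: (min_degree_eq _ (dX x xX)) => [|y]; rewrite VG.
    by rewrite !inE xX.
  by rewrite -setUA => /setUP[/dX->|/dWY].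
exists X, W, Y, (del_edges (complete X) (eset M)), (eset B); split=> //.
- split=> //.
    by rewrite -MX; apply: connected_del_edges; rewrite MX cX eM; lia.
  by rewrite esize_compl ?cX ?eM // eset_sub ?MX.
- by case: bipB.
- split; last exact/esym/eset_join_Gh.
  by rewrite VG /=; apply/setP=> x; rewrite !inE; do !case: (x \in _).
- by move=> x /dX->.
Qed.
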